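(* Let $\lambda=1/\sqrt{5}$ and let $B$ be the closed unit ball of $\mathbb{R}^3$. Then there exists a $\lambda$-eel $\gamma:[0,+\infty)\to B$ of infinite length. Moreover, $\lim_{t\to\infty}\gamma(t)$ exists.
   Context: $\mathbb{R}^3$ carries the Euclidean inner product $\langle\cdot,\cdot\rangle$ and norm $\|\cdot\|$. For $\lambda\in[-1,1)$, a $\lambda$-eel is a continuous curve $\gamma:I\to\mathbb{R}^d$ ($I$ an interval) which has at each point a nonzero right derivative $\gamma'(\tau)$ and satisfies, for all $t<\tau$ in $I$, $\langle\gamma'(\tau),\gamma(t)-\gamma(\tau)\rangle\le\lambda\,\|\gamma'(\tau)\|\,\|\gamma(t)-\gamma(\tau)\|$. The length of $\gamma$ is $\sup\sum_{i=0}^{m-1}\|\gamma(t_i)-\gamma(t_{i+1})\|$ over all finite increasing sequences $t_0<\dots<t_m$ in $I$. *)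

(* Defs.v *)
From Stdlib Require Import Reals Lra.
Open Scope R_scope.

Definition vec3 : Type := (R * R * R)%type.

Definition vadd (u v : vec3) : vec3 :=
  let '(a, b, c) := u in let '(x, y, z) := v in (a + x, b + y, c + z).
Definition vscale (k : R) (u : vec3) : vec3 :=
  let '(a, b, c) := u in (k * a, k * b, k * c).
Definition vsub (u v : vec3) : vec3 := vadd u (vscale (-1) v).
Definition vzero : vec3 := (0, 0, 0).

Definition inner (u v : vec3) : R :=
  let '(a, b, c) := u in let '(x, y, z) := v in a * x + b * y + c * z.
Definition vnorm (u : vec3) : R := sqrt (inner u u).

Definition is_right_deriv (I : R -> Prop) (g : R -> vec3) (tau : R) (v : vec3) : Prop :=
  forall eps, 0 < eps -> exists delta, 0 < delta /\
    forall h, 0 < h -> h < delta -> I (tau + h) ->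
      vnorm (vsub (vscale (/ h) (vsub (g (tau + h)) (g tau))) v) < eps.

Definition is_interval (I : R -> Prop) : Prop :=
  forall a b c, I a -> I c -> a <= b -> b <= c -> I b.

Definition continuous_on (I : R -> Prop) (g : R -> vec3) : Prop :=
  forall t, I t -> forall eps, 0 < eps -> exists delta, 0 < delta /\
    forall s, I s -> Rabs (s - t) < delta -> vnorm (vsub (g s) (g t)) < eps.

Definition is_eel (lam : R) (I : R -> Prop) (g : R -> vec3) : Prop :=
  continuous_on I g /\
  exists g' : R -> vec3,
    (forall tau, I tau -> is_right_deriv I g tau (g' tau) /\ g' tau <> vzero) /\
    (forall t tau, I t -> I tau -> t < tau ->
       inner (g' tau) (vsub (g t) (g tau))
         <= lam * vnorm (g' tau) * vnorm (vsub (g t) (g tau))).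

Fixpoint poly_length (g : R -> vec3) (ts : nat -> R) (n : nat) : R :=
  match n with
  | O => 0
  | S m => poly_length g ts m + vnorm (vsub (g (ts m)) (g (ts (S m))))
  end.

Definition infinite_length (I : R -> Prop) (g : R -> vec3) : Prop :=
  forall M : R, exists (n : nat) (ts : nat -> R),
    (forall i, (i <= n)%nat -> I (ts i)) /\
    (forall i, (i < n)%nat -> ts i < ts (S i)) /\
    M < poly_length g ts n.

(* Main.v *)
(** A helix of slope 5/2 : 1 (horizontal to vertical speed) satisfies the cone condition with
    respect to its own past, and, since 5/2 > 2 = tan (arccos (1 / sqrt 5)) leaves some slack,
    also with respect to everything inside a coaxial tube of at most a fifth of its radius.
    Hence one can climb a vertical segment along a very thin helix, move outwards to ten times
    the radius, descend along a second helix, and so on as often as one likes: a path of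
    arbitrary length within a thin tube.  Stage [k] is such a path of height [size k],
    proportional to [2 ^ -k], with [2 * 2 ^ k + 1] passes, so that every stage has length at
    least [/ 4].  The stages are stacked along the vertical axis, separated by gaps so large
    compared with their radii that a later stage sees the earlier ones in a narrow downward
    cone, which ascending and descending helices both avoid.  The heights are summable, and
    the curve converges to the origin. *)

Require Import Defs.
From Stdlib Require Import Reals Lra Lia Psatz ZArith.
Open Scope R_scope.

(** * Coordinates and elementary norm bounds *)

Definition px (v : vec3) : R := fst (fst v).
Definition py (v : vec3) : R := snd (fst v).
Definition pz (v : vec3) : R := snd v.

Lemma vnorm_coords (v : vec3) :
  vnorm v = sqrt (px v * px v + py v * py v + pz v * pz v).
Proof. now destruct v as [[x y] z]. Qed.

Lemma vsub_coords (v w : vec3) :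
  vsub v w = (px v - px w, py v - py w, pz v - pz w).
Proof.
  destruct v as [[x y] z]; destruct w as [[a b] c].
  unfold vsub, vadd, vscale, px, py, pz; simpl.
  f_equal; [f_equal|]; ring.
Qed.

Lemma vnorm_nonneg (v : vec3) : 0 <= vnorm v.
Proof. apply sqrt_pos. Qed.

Lemma Rle_mult_sqrt (c x y : R) : 0 <= c -> 0 <= y -> x * x <= c * c * y -> x <= c * sqrt y.
Proof.
  intros hc hy h.
  apply Rsqr_incr_0_var.
  - unfold Rsqr. replace (c * sqrt y * (c * sqrt y)) with (c * c * (sqrt y * sqrt y)) by ring.
    now rewrite sqrt_sqrt.
  - apply Rmult_le_pos; [assumption | apply sqrt_pos].
Qed.

Lemma Rabs_pz_le_vnorm (v : vec3) : Rabs (pz v) <= vnorm v.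
Proof.
  rewrite vnorm_coords, <- (Rmult_1_l (sqrt _)).
  apply Rle_mult_sqrt; [lra | nra |].
  assert (h := Rsqr_abs (pz v)). unfold Rsqr in h. rewrite <- h. nra.
Qed.

Lemma Rabs_px_le_vnorm (v : vec3) : Rabs (px v) <= vnorm v.
Proof.
  rewrite vnorm_coords, <- (Rmult_1_l (sqrt _)).
  apply Rle_mult_sqrt; [lra | nra |].
  assert (h := Rsqr_abs (px v)). unfold Rsqr in h. rewrite <- h. nra.
Qed.

Lemma vnorm_le_sum (v : vec3) : vnorm v <= Rabs (px v) + Rabs (py v) + Rabs (pz v).
Proof.
  assert (hx := Rabs_pos (px v)). assert (hy := Rabs_pos (py v)). assert (hz := Rabs_pos (pz v)).
  assert (ex := Rsqr_abs (px v)). assert (ey := Rsqr_abs (py v)). assert (ez := Rsqr_abs (pz v)).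
  unfold Rsqr in *.
  rewrite vnorm_coords.
  apply Rsqr_incr_0_var; [| lra].
  unfold Rsqr. rewrite sqrt_sqrt by nra. rewrite ex, ey, ez. nra.
Qed.

(** * Gluing unit-time pieces *)

(** Each piece is a formula on all of R, so a two-sided derivative is available even at the ends of
    its unit time interval. *)
Definition vderiv (f : R -> vec3) (u : R) (v : vec3) : Prop :=
  derivable_pt_lim (fun x => px (f x)) u (px v) /\
  derivable_pt_lim (fun x => py (f x)) u (py v) /\
  derivable_pt_lim (fun x => pz (f x)) u (pz v).

Lemma vderiv_quotient (f : R -> vec3) (u : R) (v : vec3) :
  vderiv f u v -> forall eps, 0 < eps -> exists delta, 0 < delta /\
    forall h, h <> 0 -> Rabs h < delta ->
      vnorm (vsub (vscale (/ h) (vsub (f (u + h)) (f u))) v) < eps.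
Proof.
  intros (hx & hy & hz) eps heps.
  destruct (hx (eps / 3)) as [dx Hx]; [lra|].
  destruct (hy (eps / 3)) as [dy Hy]; [lra|].
  destruct (hz (eps / 3)) as [dz Hz]; [lra|].
  exists (Rmin dx (Rmin dy dz)). split.
  { repeat apply Rmin_glb_lt; apply cond_pos. }
  intros h h0 hh.
  assert (h1 := Rmin_l dx (Rmin dy dz)). assert (h2 := Rmin_r dx (Rmin dy dz)).
  assert (h3 := Rmin_l dy dz). assert (h4 := Rmin_r dy dz).
  specialize (Hx h h0 ltac:(lra)). specialize (Hy h h0 ltac:(lra)).
  specialize (Hz h h0 ltac:(lra)).
  eapply Rle_lt_trans; [apply vnorm_le_sum|].
  rewrite (vsub_coords (f (u + h))), vsub_coords.
  unfold vscale; unfold px, py, pz in *; simpl in *.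
  unfold Rdiv in *. rewrite 3 (Rmult_comm (/ h)). lra.
Qed.

Lemma vderiv_continuous (f : R -> vec3) (u : R) (v : vec3) :
  vderiv f u v -> forall eps, 0 < eps -> exists delta, 0 < delta /\
    forall w, Rabs (w - u) < delta -> vnorm (vsub (f w) (f u)) < eps.
Proof.
  intros (hx & hy & hz) eps heps.
  assert (C : forall F l, derivable_pt_lim F u l -> exists delta, 0 < delta /\
     forall w, Rabs (w - u) < delta -> Rabs (F w - F u) < eps / 3).
  { intros F l hF.
    assert (hc : continuity_pt F u)
      by (apply derivable_continuous_pt; exists l; exact hF).
    destruct (hc (eps / 3)) as [a [ha Ha]]; [lra|].
    exists a; split; [exact ha|]. intros w hw.
    destruct (Req_dec u w) as [<-|hne].
    - rewrite Rminus_diag, Rabs_R0; lra.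
    - apply (Ha w). split; [split; [exact I | exact hne] | exact hw]. }
  destruct (C _ _ hx) as [dx [hdx Hx]].
  destruct (C _ _ hy) as [dy [hdy Hy]].
  destruct (C _ _ hz) as [dz [hdz Hz]].
  exists (Rmin dx (Rmin dy dz)). split.
  { repeat apply Rmin_glb_lt; assumption. }
  intros w hw.
  assert (h1 := Rmin_l dx (Rmin dy dz)). assert (h2 := Rmin_r dx (Rmin dy dz)).
  assert (h3 := Rmin_l dy dz). assert (h4 := Rmin_r dy dz).
  specialize (Hx w ltac:(lra)). specialize (Hy w ltac:(lra)). specialize (Hz w ltac:(lra)).
  eapply Rle_lt_trans; [apply vnorm_le_sum|].
  rewrite vsub_coords. unfold px, py, pz in *; simpl. lra.
Qed.

Definition nfloor (t : R) : nat := Z.to_nat (Int_part t).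

Lemma nfloor_unique (n : nat) (t : R) : INR n <= t < INR n + 1 -> nfloor t = n.
Proof.
  intros h. unfold nfloor.
  assert (e : Z.of_nat n = Int_part t).
  { apply Int_part_spec. rewrite <- INR_IZR_INZ. lra. }
  rewrite <- e. apply Nat2Z.id.
Qed.

Lemma nfloor_bounds (t : R) : 0 <= t -> INR (nfloor t) <= t < INR (nfloor t) + 1.
Proof.
  intros h. unfold nfloor. destruct (base_Int_part t) as [h1 h2].
  assert (hz : (0 <= Int_part t)%Z).
  { assert (-1 < Int_part t)%Z by (apply lt_IZR; lra). lia. }
  rewrite INR_IZR_INZ, Z2Nat.id by exact hz. lra.
Qed.

(** At an integer time [n] the value comes from the start of piece [n]. Gluing the velocities by the
    same rule therefore yields the right derivative at the joins. *)
Definition glue (c : nat -> R -> vec3) (t : R) : vec3 :=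
  c (nfloor t) (t - INR (nfloor t)).

Lemma glue_piece (c : nat -> R -> vec3) (n : nat) (t : R) :
  (forall m, c m 1 = c (S m) 0) -> INR n <= t <= INR n + 1 -> glue c t = c n (t - INR n).
Proof.
  intros hc [h1 h2]. unfold glue.
  destruct (Rle_lt_or_eq_dec _ _ h2) as [h|h].
  - now rewrite (nfloor_unique n t).
  - rewrite (nfloor_unique (S n) t) by (rewrite S_INR; lra).
    rewrite h, S_INR. replace (INR n + 1 - (INR n + 1)) with 0 by ring.
    replace (INR n + 1 - INR n) with 1 by ring. now rewrite hc.
Qed.

Lemma glue_continuous (c c' : nat -> R -> vec3) :
  (forall m, c m 1 = c (S m) 0) -> (forall n u, vderiv (c n) u (c' n u)) ->
  continuous_on (fun t => 0 <= t) (glue c).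
Proof.
  intros hc hd t ht eps heps.
  assert (one : forall n, INR n <= t <= INR n + 1 -> exists delta, 0 < delta /\
     forall s, INR n <= s <= INR n + 1 -> Rabs (s - t) < delta ->
       vnorm (vsub (glue c s) (glue c t)) < eps).
  { intros n hn.
    destruct (vderiv_continuous _ _ _ (hd n (t - INR n)) eps heps) as [a [ha Ha]].
    exists a; split; [exact ha|]. intros s hs hst.
    rewrite (glue_piece c n s), (glue_piece c n t) by assumption.
    apply Ha. replace (s - INR n - (t - INR n)) with (s - t) by ring. exact hst. }
  pose proof (nfloor_bounds t ht) as hn. set (n := nfloor t) in *.
  destruct (one n) as [a [ha Ha]]; [lra|].
  destruct (Rle_lt_or_eq_dec _ _ (proj1 hn)) as [h|h].
  - exists (Rmin a (Rmin (t - INR n) (INR n + 1 - t))). split.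
    { repeat apply Rmin_glb_lt; lra. }
    intros s hs hst.
    assert (h1 := Rmin_l a (Rmin (t - INR n) (INR n + 1 - t))).
    assert (h2 := Rmin_r a (Rmin (t - INR n) (INR n + 1 - t))).
    assert (h3 := Rmin_l (t - INR n) (INR n + 1 - t)).
    assert (h4 := Rmin_r (t - INR n) (INR n + 1 - t)).
    apply Ha; [|lra].
    assert (hl := Rle_abs (s - t)). assert (hr := Rle_abs (- (s - t))).
    rewrite Rabs_Ropp in hr. lra.
  (* An integer time [t] also needs the piece to its left, unless [t = 0]. *)
  - destruct n as [|m].
    + simpl in *. exists (Rmin a 1). split; [apply Rmin_glb_lt; lra|].
      intros s hs hst. assert (h1 := Rmin_l a 1). assert (h2 := Rmin_r a 1).
      apply Ha; [|lra]. assert (hl := Rle_abs (s - t)). lra.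
    + rewrite S_INR in *. destruct (one m) as [b [hb Hb]]; [lra|].
      exists (Rmin (Rmin a b) 1). split; [repeat apply Rmin_glb_lt; lra|].
      intros s hs hst.
      assert (h1 := Rmin_l (Rmin a b) 1). assert (h2 := Rmin_r (Rmin a b) 1).
      assert (h3 := Rmin_l a b). assert (h4 := Rmin_r a b).
      assert (hl := Rle_abs (s - t)). assert (hr := Rle_abs (- (s - t))).
      rewrite Rabs_Ropp in hr.
      destruct (Rle_or_lt t s); [apply Ha | apply Hb]; lra.
Qed.

Lemma glue_right_deriv (c c' : nat -> R -> vec3) (t : R) :
  (forall n u, vderiv (c n) u (c' n u)) -> 0 <= t ->
  is_right_deriv (fun t => 0 <= t) (glue c) t (glue c' t).
Proof.
  intros hd ht eps heps.
  pose proof (nfloor_bounds t ht) as hn. unfold glue at 3. set (n := nfloor t) in *.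
  destruct (vderiv_quotient _ _ _ (hd n (t - INR n)) eps heps) as [a [ha Ha]].
  exists (Rmin a (INR n + 1 - t)). split; [apply Rmin_glb_lt; lra|].
  intros h h0 hh _.
  assert (h1 := Rmin_l a (INR n + 1 - t)). assert (h2 := Rmin_r a (INR n + 1 - t)).
  unfold glue. fold n. rewrite (nfloor_unique n (t + h)) by lra.
  replace (t + h - INR n) with (t - INR n + h) by ring.
  apply Ha; [lra|]. rewrite Rabs_right; lra.
Qed.

(** * The helix estimates *)

(** The hypothesis on [c] says [c <= vnorm d / sqrt 5]. It removes the irrational constant from all
    later estimates. *)
Lemma cone_condition_of_bound (c : R) (d w : vec3) :
  0 <= c -> 5 * (c * c) <= inner d d -> inner d w <= c * vnorm w ->
  inner d w <= 1 / sqrt 5 * vnorm d * vnorm w.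
Proof.
  intros hc hd h. eapply Rle_trans; [exact h|].
  apply Rmult_le_compat_r; [apply vnorm_nonneg|].
  unfold vnorm. apply Rle_mult_sqrt.
  - apply Rlt_le, Rdiv_lt_0_compat; [lra | apply sqrt_lt_R0; lra].
  - nra.
  - replace (1 / sqrt 5 * (1 / sqrt 5)) with (/ 5).
    + lra.
    + rewrite <- (sqrt_sqrt 5) at 1 by lra. field.
      assert (0 < sqrt 5) by (apply sqrt_lt_R0; lra). lra.
Qed.

Lemma unit_dot_le (a b x y w : R) :
  a * a + b * b = 1 -> 0 <= w -> x * x + y * y <= w * w -> a * x + b * y <= w.
Proof.
  intros h hw hxy. apply Rsqr_incr_0_var; [|exact hw]. unfold Rsqr.
  assert (0 <= (a * y - b * x) * (a * y - b * x)) by apply Rle_0_sqr.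
  assert ((a * x + b * y) * (a * x + b * y) + (a * y - b * x) * (a * y - b * x)
          = (a * a + b * b) * (x * x + y * y)) by ring.
  rewrite h in *. lra.
Qed.

Lemma cos_sin_unit (th : R) : cos th * cos th + sin th * sin th = 1.
Proof. generalize (sin2_cos2 th). unfold Rsqr. lra. Qed.

(** The tangent is horizontally orthogonal to the radius vector, so the horizontal term is at most
    [5/2 * r/5 = r/2], while the horizontal distance is at least [4r/5]. By Cauchy-Schwarz,
    [r/2 + sg * t = 5/8 * (4r/5) + sg * t] is at most [sqrt 89 / 8 < 6/5] times the distance. *)
Lemma helix_avoids_thin_tube (r th sg x y t : R) :
  0 <= r -> sg * sg = 1 -> x * x + y * y <= (r / 5) * (r / 5) ->
  5 / 2 * (- sin th * x + cos th * y) + sg * t <=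
    6 / 5 * sqrt ((x - r * cos th) * (x - r * cos th)
                  + (y - r * sin th) * (y - r * sin th) + t * t).
Proof.
  intros hr hsg hxy.
  assert (hu := cos_sin_unit th).
  assert (h1 : - sin th * x + cos th * y <= r / 5) by (apply unit_dot_le; lra).
  assert (h2 : cos th * x + sin th * y <= r / 5) by (apply unit_dot_le; lra).
  set (v := cos th * x + sin th * y) in *.
  (* In coordinates rotated by [th], [v] is the radial component of the point. From [v <= r/5] the
     radial gap [r - v] is at least [4r/5]. *)
  assert (hD : 4 * r / 5 * (4 * r / 5) + t * t <=
     (x - r * cos th) * (x - r * cos th) + (y - r * sin th) * (y - r * sin th) + t * t).
  { replace ((x - r * cos th) * (x - r * cos th) + (y - r * sin th) * (y - r * sin th) + t * t)
      with ((cos th * cos th + sin th * sin th) * (x * x + y * y) - 2 * r * v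
            + r * r * (cos th * cos th + sin th * sin th) + t * t)
      by (unfold v; rewrite hu; ring_simplify;
          replace (cos th ^ 2) with (1 - sin th ^ 2) by (simpl; lra); ring).
    replace ((cos th * cos th + sin th * sin th) * (x * x + y * y))
      with (v * v + (cos th * y - sin th * x) * (cos th * y - sin th * x))
      by (unfold v; ring).
    rewrite hu.
    assert (0 <= (cos th * y - sin th * x) * (cos th * y - sin th * x)) by apply Rle_0_sqr.
    nra. }
  apply Rle_trans with (r / 2 + sg * t); [lra|].
  apply Rle_trans with (6 / 5 * sqrt (4 * r / 5 * (4 * r / 5) + t * t)).
  - apply Rle_mult_sqrt; [lra | nra |].
    assert (0 <= (r - 2 * (sg * t)) * (r - 2 * (sg * t))) by apply Rle_0_sqr.
    assert (e : (sg * t) * (sg * t) = t * t)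
      by (replace (sg * t * (sg * t)) with (sg * sg * (t * t)) by ring; rewrite hsg; ring).
    assert (0 <= (2 / 3 * r - 3 / 4 * (sg * t)) * (2 / 3 * r - 3 / 4 * (sg * t))) by apply Rle_0_sqr.
    nra.
  - apply Rmult_le_compat_l; [lra|]. now apply sqrt_le_1_alt.
Qed.

(** The horizontal term is at most [5/2 * 2/25 = 1/5] of the height difference, and the vertical
    term at most once that difference; together they give [6/5]. *)
Lemma helix_avoids_narrow_cone (r th sg x y t : R) :
  sg * sg = 1 -> x * x + y * y <= (2 / 25 * t) * (2 / 25 * t) ->
  5 / 2 * (- sin th * x + cos th * y) + sg * t <=
    6 / 5 * sqrt ((x - r * cos th) * (x - r * cos th)
                  + (y - r * sin th) * (y - r * sin th) + t * t).
Proof.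
  intros hsg hxy.
  assert (hu := cos_sin_unit th).
  assert (ht := Rabs_pos t). assert (et := Rsqr_abs t). unfold Rsqr in et.
  assert (h1 : - sin th * x + cos th * y <= 2 / 25 * Rabs t) by (apply unit_dot_le; nra).
  assert (h2 : sg * t <= Rabs t).
  { apply Rsqr_incr_0_var; [|exact ht]. unfold Rsqr. rewrite <- et.
    replace (sg * t * (sg * t)) with (sg * sg * (t * t)) by ring. rewrite hsg. lra. }
  apply Rle_trans with (6 / 5 * Rabs t); [lra|].
  apply Rmult_le_compat_l; [lra|].
  rewrite <- (Rmult_1_l (sqrt _)).
  assert (0 <= (x - r * cos th) * (x - r * cos th)) by apply Rle_0_sqr.
  assert (0 <= (y - r * sin th) * (y - r * sin th)) by apply Rle_0_sqr.
  assert (0 <= t * t) by apply Rle_0_sqr.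
  apply Rle_mult_sqrt; lra.
Qed.

(* At polar angle [phi] behind the current point the helix has dropped by [h >= 2/5 r phi];
   for [phi <= PI] the horizontal term has the good sign, and beyond [PI] the drop wins. *)
Lemma helix_avoids_own_past (r x phi h n : R) :
  0 <= x <= r -> 0 <= phi -> 2 / 5 * (r * phi) <= h -> h <= n ->
  - (5 / 2) * x * sin phi - h <= 6 / 5 * n.
Proof.
  intros hx hphi hh hn.
  assert (0 <= r * phi) by nra.
  destruct (Rle_or_lt phi PI) as [hp|hp].
  - assert (hs := sin_ge_0 phi hphi hp). assert (0 <= x * sin phi) by nra. nra.
  - assert (h3 := PI2_3_2).
    assert (hs : -1 <= sin phi) by apply SIN_bound.
    assert (- (x * sin phi) <= r) by nra.
    assert (3 * r <= r * phi) by nra. lra.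
Qed.

(** * The curve *)

(** The index [j] counts the passes of stage [k] down to the outermost, [j = 0]. It starts at the
    even number [2 * 2 ^ k], so the first and the last helix both ascend and the stage is left at
    its top. *)
Inductive piece : Type :=
| Entry (k : nat)
| Radial (k j : nat)
| Helix (k j : nat).

Definition next (p : piece) : piece :=
  match p with
  | Entry k => Radial k (2 * 2 ^ k)
  | Radial k j => Helix k j
  | Helix k O => Entry (S k)
  | Helix k (S j) => Radial k j
  end.

Definition size (k : nat) : R := / 8 * (/ 2) ^ k.
(** Makes [base (S k) = base k + 2 * size k]: between the top of stage [k] and the bottom of the
    next there is a gap of [size k]. *)
Definition base (k : nat) : R := - 4 * size k.
(** A whole number of turns brings each helix back to angle 0. The factor 10 per index gives the
    ratio of successive radii, and the offset 2 keeps all radii of stage [k] below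
    [size k / 240]. *)
Definition turns (j : nat) : nat := (10 ^ (j + 2))%nat.
Definition omega (j : nat) : R := 2 * INR (turns j) * PI.
(** Chosen so that the horizontal speed [radius k j * omega j] is [5/2] times the vertical speed
    [size k]. *)
Definition radius (k j : nat) : R := 5 / 2 * size k / omega j.
Definition sense (j : nat) : R := if Nat.even j then 1 else -1.
Definition level (k j : nat) : R := if Nat.even j then base k else base k + size k.

(* [2 * radius k 0] is the outer radius of stage [k - 1]. *)
Definition point (p : piece) (u : R) : vec3 :=
  match p with
  | Entry k =>
      ((1 - u) * (2 * radius k 0) + u * radius k (S (2 * 2 ^ k)), 0,
       base k - 2 * size k * (1 - u))
  | Radial k j => ((1 - u) * radius k (S j) + u * radius k j, 0, level k j)
  | Helix k j =>
      (radius k j * cos (omega j * u), radius k j * sin (omega j * u),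
       level k j + sense j * size k * u)
  end.

Definition velocity (p : piece) (u : R) : vec3 :=
  match p with
  | Entry k => (radius k (S (2 * 2 ^ k)) - 2 * radius k 0, 0, 2 * size k)
  | Radial k j => (radius k j - radius k (S j), 0, 0)
  | Helix k j =>
      (size k * (5 / 2 * - sin (omega j * u)), size k * (5 / 2 * cos (omega j * u)),
       size k * sense j)
  end.

Lemma size_pos (k : nat) : 0 < size k.
Proof. unfold size. apply Rmult_lt_0_compat; [lra | apply pow_lt; lra]. Qed.

Lemma size_S (k : nat) : size (S k) = size k / 2.
Proof. unfold size; simpl; field. Qed.

Lemma turns_S (j : nat) : INR (turns (S j)) = 10 * INR (turns j).
Proof.
  unfold turns. rewrite !pow_INR. replace (S j + 2)%nat with (S (j + 2)) by lia.
  rewrite <- tech_pow_Rmult. f_equal. rewrite INR_IZR_INZ. reflexivity.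
Qed.

Lemma turns_ge (j : nat) : 100 <= INR (turns j).
Proof.
  induction j as [|j IH]; [|rewrite turns_S; lra].
  unfold turns. rewrite pow_INR, INR_IZR_INZ. simpl. lra.
Qed.

Lemma omega_ge (j : nat) : 600 <= omega j.
Proof.
  unfold omega. assert (h := turns_ge j). assert (hp := PI2_3_2).
  assert (100 * 3 <= INR (turns j) * PI) by (apply Rmult_le_compat; lra). lra.
Qed.

Lemma omega_S (j : nat) : omega (S j) = 10 * omega j.
Proof. unfold omega. rewrite turns_S. ring. Qed.

Lemma radius_omega (k j : nat) : radius k j * omega j = 5 / 2 * size k.
Proof. unfold radius. field. assert (h := omega_ge j). lra. Qed.

Lemma radius_pos (k j : nat) : 0 < radius k j.
Proof.
  unfold radius. assert (h := omega_ge j). assert (hs := size_pos k).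
  apply Rdiv_lt_0_compat; lra.
Qed.

Lemma radius_le (k j : nat) : radius k j <= size k / 240.
Proof.
  assert (h := omega_ge j). assert (hr := radius_pos k j).
  assert (e := radius_omega k j). nra.
Qed.

Lemma radius_Sr (k j : nat) : radius k (S j) = radius k j / 10.
Proof. unfold radius. rewrite omega_S. field. assert (h := omega_ge j). lra. Qed.

Lemma radius_Sl (k j : nat) : radius (S k) j = radius k j / 2.
Proof. unfold radius. rewrite size_S. field. assert (h := omega_ge j). lra. Qed.

Lemma base_S (k : nat) : base (S k) = base k + 2 * size k.
Proof. unfold base. rewrite size_S. field. Qed.

Lemma cos_omega (j : nat) : cos (omega j) = 1.
Proof. unfold omega. rewrite <- (Rplus_0_l (2 * _ * PI)), cos_period. apply cos_0. Qed.

Lemma sin_omega (j : nat) : sin (omega j) = 0.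
Proof. unfold omega. rewrite <- (Rplus_0_l (2 * _ * PI)), sin_period. apply sin_0. Qed.

Lemma sense_sqr (j : nat) : sense j * sense j = 1.
Proof. unfold sense. destruct (Nat.even j); lra. Qed.

Lemma level_end (k j : nat) : level k (S j) + sense (S j) * size k = level k j.
Proof.
  unfold level, sense. rewrite Nat.even_succ, <- Nat.negb_even.
  destruct (Nat.even j); simpl; lra.
Qed.

Lemma level_range (k j : nat) (u : R) : 0 <= u <= 1 ->
  base k <= level k j + sense j * size k * u <= base k + size k.
Proof.
  intros hu. assert (hs := size_pos k). assert (0 <= size k * u <= size k) by nra.
  unfold level, sense. destruct (Nat.even j); lra.
Qed.

Lemma even_first (k : nat) : Nat.even (2 * 2 ^ k) = true.
Proof. now rewrite Nat.even_mul. Qed.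

Lemma point_join (p : piece) : point p 1 = point (next p) 0.
Proof.
  destruct p as [k|k j|k j]; unfold point, next.
  - f_equal; [f_equal; ring|]. unfold level. rewrite even_first. ring.
  - rewrite !Rmult_0_r, cos_0, sin_0. f_equal; [f_equal|]; ring.
  - destruct j as [|j]; rewrite Rmult_1_r, cos_omega, sin_omega.
    + rewrite radius_Sl, base_S, size_S. unfold level, sense; simpl.
      f_equal; [f_equal|]; field.
    + rewrite <- (level_end k j). f_equal; [f_equal|]; ring.
Qed.

Lemma vderiv_point (p : piece) (u : R) : vderiv (point p) u (velocity p u).
Proof.
  assert (aff : forall a b : R, derivable_pt_lim (fun x => a + b * x) u b).
  { intros a b eps heps. exists (mkposreal 1 Rlt_0_1). intros h h0 _.
    replace ((a + b * (u + h) - (a + b * u)) / h - b) with 0 by (field; exact h0).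
    now rewrite Rabs_R0. }
  assert (ext : forall f g l, (forall x, f x = g x) ->
    derivable_pt_lim f u l -> derivable_pt_lim g u l).
  { intros f g l e h eps heps. destruct (h eps heps) as [d hd]. exists d.
    intros x. rewrite <- !e. apply hd. }
  destruct p as [k|k j|k j]; unfold vderiv, px, py, pz; simpl; repeat split.
  - eapply ext; [|apply (aff (2 * radius k 0))]. intros x; simpl; ring.
  - apply derivable_pt_lim_const.
  - eapply ext; [|apply (aff (base k - 2 * size k))]. intros x; simpl; ring.
  - eapply ext; [|apply (aff (radius k (S j)))]. intros x; simpl; ring.
  - apply derivable_pt_lim_const.
  - apply derivable_pt_lim_const.
  - replace (size k * (5 / 2 * - sin (omega j * u)))
      with (radius k j * (- sin (omega j * u) * omega j)) by (generalize (radius_omega k j); nra).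
    apply (derivable_pt_lim_scal (fun x => cos (omega j * x))).
    apply (derivable_pt_lim_comp (fun x => omega j * x) cos); [|apply derivable_pt_lim_cos].
    eapply ext; [|apply (aff 0)]. intros x; simpl; ring.
  - replace (size k * (5 / 2 * cos (omega j * u)))
      with (radius k j * (cos (omega j * u) * omega j)) by (generalize (radius_omega k j); nra).
    apply (derivable_pt_lim_scal (fun x => sin (omega j * x))).
    apply (derivable_pt_lim_comp (fun x => omega j * x) sin); [|apply derivable_pt_lim_sin].
    eapply ext; [|apply (aff 0)]. intros x; simpl; ring.
  - eapply ext; [|apply (aff (level k j))]. intros x; simpl; ring.
Qed.

Lemma velocity_neq0 (p : piece) (u : R) : velocity p u <> vzero.
Proof.
  intros e. assert (ex := f_equal px e). assert (ez := f_equal pz e).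
  destruct p as [k|k j|k j]; unfold px, pz in *; simpl in *.
  - assert (h := size_pos k). lra.
  - rewrite radius_Sr in ex. assert (h := radius_pos k j). lra.
  - assert (h := size_pos k). assert (hs := sense_sqr j). nra.
Qed.

(** * The region swept before each piece *)

Definition near_axis (r : R) (v : vec3) : Prop :=
  px v * px v + py v * py v <= r * r.

(* A tube around the axis, flaring below height [base k] into a cone that contains the
   wider tubes of the earlier stages. *)
Definition tube (k : nat) (r : R) (v : vec3) : Prop :=
  pz v <= base k + size k /\ near_axis (r + / 25 * Rmax 0 (base k - pz v)) v.

(** An invariant region containing everything traversed before [p]. The second alternative for a
    helix covers the radial move just made, which leaves the thin tube; the segment is prolonged
    back to the axis. *)
Definition before (p : piece) (v : vec3) : Prop :=
  match p with
  | Entry k => pz v <= base k - 2 * size k /\ near_axis (/ 25 * (base k - pz v)) v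
  | Radial k j => tube k (radius k (S j)) v
  | Helix k j =>
      tube k (radius k (S j)) v \/
      (0 <= px v <= radius k j /\ py v = 0 /\ pz v = level k j)
  end.

Definition cone_condition (d w : vec3) : Prop :=
  inner d w <= 1 / sqrt 5 * vnorm d * vnorm w.

Lemma near_axis_le (r s : R) (v : vec3) : 0 <= r <= s -> near_axis r v -> near_axis s v.
Proof. unfold near_axis. nra. Qed.

Lemma tube_le (k : nat) (r s : R) (v : vec3) : 0 <= r <= s -> tube k r v -> tube k s v.
Proof.
  intros h [h1 h2]; split; [exact h1|].
  assert (hm := Rmax_l 0 (base k - pz v)).
  eapply near_axis_le; [|exact h2]. lra.
Qed.

Lemma tube_of_near_axis (k : nat) (r : R) (v : vec3) :
  0 <= r -> pz v <= base k + size k -> near_axis r v -> tube k r v.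
Proof.
  intros h h1 h2; split; [exact h1|].
  assert (hm := Rmax_l 0 (base k - pz v)).
  eapply near_axis_le; [|exact h2]. lra.
Qed.

(** The cone for stage [S k] has its apex [2 * size k] above [base k], so at the top of stage [k]
    its radius is already [size k / 25], more than the outer radius [size k / 240] at most. *)
Lemma tube_before_entry (k : nat) (v : vec3) :
  tube k (radius k 0) v -> before (Entry (S k)) v.
Proof.
  intros [h1 h2]. assert (hs := size_pos k). assert (hr := radius_le k 0).
  assert (hr0 := radius_pos k 0).
  simpl. rewrite base_S, size_S. split; [lra|].
  eapply near_axis_le; [|exact h2]. split.
  - assert (hm := Rmax_l 0 (base k - pz v)). lra.
  - apply Rmax_case; lra.
Qed.

Lemma before_next (p : piece) (v : vec3) : before p v -> before (next p) v.
Proof.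
  destruct p as [k|k j|k j]; simpl.
  - intros [h1 h2]. assert (hs := size_pos k). split; [lra|].
    rewrite Rmax_right by lra. eapply near_axis_le; [|exact h2].
    assert (hr := radius_pos k (S (2 * 2 ^ k))). simpl in hr. lra.
  - now left.
  - assert (hr := radius_pos k j). assert (hs := size_pos k).
    (* The wider tube of radius [radius k j] absorbs both the inner tube and the radial segment. *)
    assert (H : (tube k (radius k (S j)) v \/
      (0 <= px v <= radius k j /\ py v = 0 /\ pz v = level k j)) -> tube k (radius k j) v).
    { intros [h|(h1 & h2 & h3)].
      - eapply tube_le; [|exact h]. rewrite radius_Sr. lra.
      - apply tube_of_near_axis; [lra| |].
        + assert (hl := level_range k j 0 ltac:(lra)). lra.
        + unfold near_axis. rewrite h2. nra. }
    intros h. apply H in h. destruct j as [|j]; [|exact h].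
    now apply tube_before_entry.
Qed.

Lemma point_before_next (p : piece) (u : R) :
  0 <= u <= 1 -> before (next p) (point p u).
Proof.
  intros hu.
  destruct p as [k|k j|k j]; unfold next.
  - assert (hs := size_pos k). assert (hr := radius_pos k (S (2 * 2 ^ k))).
    assert (hr0 := radius_pos k 0). assert (hr1 := radius_le k 0).
    unfold before, tube, near_axis, point, px, py, pz.
    cbn [fst snd]. assert (0 <= size k * (1 - u)) by nra. split; [lra|].
    rewrite Rmax_right by lra.
    set (r := radius k (S (2 * 2 ^ k))) in *.
    (* The share of the old outer radius shrinks in proportion to the depth below [base k], so the
       flare covers it; the tube itself covers the share [u * r]. *)
    assert (0 <= (1 - u) * (2 * radius k 0) <= / 25 * (2 * size k * (1 - u))) by nra.
    assert (0 <= u * r <= r) by nra. nra.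
  - right. unfold point, px, py, pz; cbn [fst snd].
    assert (hr := radius_pos k j). assert (hr1 := radius_pos k (S j)).
    rewrite radius_Sr in *. repeat split; nra.
  - assert (H : tube k (radius k j) (point (Helix k j) u)).
    { apply tube_of_near_axis.
      - apply Rlt_le, radius_pos.
      - apply level_range, hu.
      - unfold near_axis, point, px, py; cbn [fst snd].
        assert (h := cos_sin_unit (omega j * u)). nra. }
    destruct j as [|j]; [|exact H]. now apply tube_before_entry.
Qed.

(** * The cone condition on each piece *)

Lemma helix_cone_condition (k j : nat) (u : R) (v : vec3) :
  5 / 2 * (- sin (omega j * u) * px v + cos (omega j * u) * py v)
    + sense j * (pz v - (level k j + sense j * size k * u))
    <= 6 / 5 * vnorm (vsub v (point (Helix k j) u)) ->
  cone_condition (velocity (Helix k j) u) (vsub v (point (Helix k j) u)).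
Proof.
  intros E. assert (hs := size_pos k).
  assert (hu := cos_sin_unit (omega j * u)). assert (hsg := sense_sqr j).
  (* The squared speed is [29/4 * size k ^ 2], and [5 * (6/5)^2 = 36/5 < 29/4]. *)
  apply cone_condition_of_bound with (6 / 5 * size k); [lra | |].
  - unfold velocity, inner.
    replace (size k * (5 / 2 * - sin (omega j * u)) * (size k * (5 / 2 * - sin (omega j * u)))
      + size k * (5 / 2 * cos (omega j * u)) * (size k * (5 / 2 * cos (omega j * u)))
      + size k * sense j * (size k * sense j))
    with (size k * size k * (25 / 4 * (cos (omega j * u) * cos (omega j * u)
      + sin (omega j * u) * sin (omega j * u)) + sense j * sense j)) by field.
    rewrite hu, hsg. nra.
  - apply Rle_trans with (size k * (6 / 5 * vnorm (vsub v (point (Helix k j) u)))); [|lra].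
    eapply Rle_trans; [|apply Rmult_le_compat_l; [lra | exact E]].
    apply Req_le. rewrite vsub_coords. unfold velocity, inner, point.
    unfold px, py, pz; cbn [fst snd]. ring.
Qed.

(** Here [v] lags by time [d]: it has the angle and height of the helix at time [u - d], but
    possibly a smaller distance [x] from the axis. This treats the helix itself ([x = radius k j])
    and the preceding radial segment ([d = u]) at once. *)
Lemma helix_cone_condition_recent (k j : nat) (u x d : R) (v : vec3) :
  0 <= x <= radius k j -> 0 <= d ->
  - sin (omega j * u) * px v + cos (omega j * u) * py v = - x * sin (omega j * d) ->
  pz v - (level k j + sense j * size k * u) = - (sense j * (size k * d)) ->
  cone_condition (velocity (Helix k j) u) (vsub v (point (Helix k j) u)).
Proof.
  intros hx hd hxy hz. apply helix_cone_condition. rewrite hxy, hz.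
  assert (hs := size_pos k). assert (hw := omega_ge j). assert (hrw := radius_omega k j).
  assert (hsg := sense_sqr j).
  assert (hth : 0 <= omega j * d) by nra.
  assert (hh : 2 / 5 * (radius k j * (omega j * d)) <= size k * d) by nra.
  assert (hn : size k * d <= vnorm (vsub v (point (Helix k j) u))).
  { eapply Rle_trans; [|apply Rabs_pz_le_vnorm].
    rewrite vsub_coords. unfold point, pz in *; cbn [fst snd] in *.
    rewrite hz, Rabs_Ropp, Rabs_mult, (Rabs_right (size k * d)) by nra.
    replace (Rabs (sense j)) with 1
      by (symmetry; unfold sense; destruct (Nat.even j); [apply Rabs_R1 | rewrite Rabs_left; lra]).
    lra. }
  assert (H := helix_avoids_own_past _ _ _ _ _ hx hth hh hn).
  replace (sense j * - (sense j * (size k * d)))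
    with (- (sense j * sense j * (size k * d))) by ring.
  rewrite hsg. lra.
Qed.

Lemma before_cone_condition (p : piece) (v : vec3) (u : R) :
  0 <= u <= 1 -> before p v -> cone_condition (velocity p u) (vsub v (point p u)).
Proof.
  intros hu.
  assert (hx := Rabs_px_le_vnorm (vsub v (point p u))).
  assert (hz := Rabs_pz_le_vnorm (vsub v (point p u))).
  assert (hn := vnorm_nonneg (vsub v (point p u))).
  destruct p as [k|k j|k j].
  - intros [h1 h2]. assert (hs := size_pos k). assert (hr := radius_pos k (S (2 * 2 ^ k))).
    assert (hr0 := radius_pos k 0). assert (hr1 := radius_le k 0).
    assert (hr2 := radius_le k (S (2 * 2 ^ k))).
    (* The past lies below, so the vertical term is nonpositive; the horizontal speed is less than
       [size k / 50]. *)
    apply cone_condition_of_bound with (/ 50 * size k);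
      [lra | unfold velocity, inner; nra |].
    rewrite vsub_coords in *. set (n := vnorm _) in *.
    unfold velocity, inner, point, px, py, pz in *; cbn [fst snd] in *.
    set (r := radius k (S (2 * 2 ^ k))) in *.
    set (a := fst (fst v) - _) in *.
    assert (0 <= size k * u) by nra.
    set (b := snd v - _) in *. assert (b <= 0) by (unfold b; lra).
    assert (size k * b <= 0) by nra.
    assert ((r - 2 * radius k 0) * a <= / 50 * size k * n).
    { apply Rle_trans with (Rabs (r - 2 * radius k 0) * n).
      - eapply Rle_trans; [apply Rle_abs|]. rewrite Rabs_mult.
        apply Rmult_le_compat_l; [apply Rabs_pos | lra].
      - apply Rmult_le_compat_r; [exact hn|]. apply Rabs_le. lra. }
    lra.
  - intros [h1 h2]. assert (hr := radius_pos k j). assert (hr1 := radius_Sr k j).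
    (* The move runs outwards from the edge of the tube. Only the flare can reach further out than
       the current point, by at most [1/25] of the depth below [base k]. *)
    apply cone_condition_of_bound with (/ 25 * (radius k j - radius k (S j)));
      [lra | unfold velocity, inner; nra |].
    rewrite vsub_coords in *. set (n := vnorm _) in *.
    unfold velocity, inner, point, near_axis, px, py, pz in *; cbn [fst snd] in *.
    assert (hm := Rmax_l 0 (base k - snd v)).
    assert (fst (fst v) <= radius k (S j) + / 25 * Rmax 0 (base k - snd v)).
    { apply Rsqr_incr_0_var; unfold Rsqr; nra. }
    assert (hl := level_range k j 0 ltac:(lra)).
    assert (ha := Rle_abs (- (snd v - level k j))). rewrite Rabs_Ropp in ha.
    assert (Rmax 0 (base k - snd v) <= n) by (apply Rmax_case; lra).
    assert (fst (fst v) - ((1 - u) * radius k (S j) + u * radius k j) <= / 25 * n) by nra.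
    nra.
  - assert (hr := radius_pos k j). assert (hl := level_range k j u hu).
    intros [[h1 h2]|(h1 & h2 & h3)].
    + apply helix_cone_condition.
      rewrite vsub_coords, vnorm_coords. unfold point, near_axis in *.
      unfold px, py, pz in *; cbn [fst snd] in *.
      rewrite radius_Sr in h2.
      (* The tube radius is [radius k j / 10] plus the flare. If the flare is the smaller summand,
         the total is at most a fifth of the radius; otherwise it is at most [2/25] of the depth. *)
      destruct (Rle_or_lt (/ 25 * Rmax 0 (base k - snd v)) (radius k j / 10)) as [hc|hc].
      * apply helix_avoids_thin_tube; [lra | apply sense_sqr |].
        assert (hm := Rmax_l 0 (base k - snd v)). nra.
      * apply helix_avoids_narrow_cone; [apply sense_sqr|].
        revert h2 hc. apply Rmax_case; intros h2 hc; [lra|].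
        set (t := base k - snd v) in *.
        set (t' := snd v - _) in *. assert (t <= - t') by (unfold t, t'; lra).
        assert (2 / 25 * t * (2 / 25 * t) <= 2 / 25 * t' * (2 / 25 * t')) by nra.
        nra.
    + apply helix_cone_condition_recent with (px v) u; [exact h1 | lra | |].
      * rewrite h2. ring.
      * rewrite h3. ring.
Qed.

(** On a segment the past lies straight behind, so the inner product is nonpositive; on a helix the
    lag is [u - w]. *)
Lemma own_cone_condition (p : piece) (w u : R) :
  w <= u -> cone_condition (velocity p u) (vsub (point p w) (point p u)).
Proof.
  intros h. assert (segment : forall a b x y z : R,
    x = (w - u) * a -> y = 0 -> z = (w - u) * b -> cone_condition (a, 0, b) (x, y, z)).
  { intros a b x y z -> -> ->. unfold cone_condition.
    apply Rle_trans with 0.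
    - unfold inner. assert (0 <= a * a) by apply Rle_0_sqr.
      assert (0 <= b * b) by apply Rle_0_sqr. nra.
    - apply Rmult_le_pos; [apply Rmult_le_pos|]; try apply vnorm_nonneg.
      apply Rlt_le, Rdiv_lt_0_compat; [lra | apply sqrt_lt_R0; lra]. }
  destruct p as [k|k j|k j].
  - rewrite vsub_coords. unfold point, velocity, px, py, pz; cbn [fst snd].
    apply segment; ring.
  - rewrite vsub_coords. unfold point, velocity, px, py, pz; cbn [fst snd].
    apply segment; ring.
  - apply helix_cone_condition_recent with (radius k j) (u - w).
    + assert (hr := radius_pos k j). lra.
    + lra.
    + unfold point, px, py; cbn [fst snd].
      rewrite Rmult_minus_distr_l, sin_minus. ring.
    + unfold point, pz; cbn [fst snd]. ring.
Qed.

(** * The eel and its cone condition *)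

Definition track (n : nat) : piece := Nat.iter n next (Entry 0).

Definition eel : R -> vec3 := glue (fun n => point (track n)).

Lemma track_join (n : nat) : point (track n) 1 = point (track (S n)) 0.
Proof. apply point_join. Qed.

Lemma eel_INR (n : nat) : eel (INR n) = point (track n) 0.
Proof.
  unfold eel. rewrite (glue_piece _ n); [|exact track_join | lra].
  now rewrite Rminus_diag.
Qed.

Lemma point_before_track (m n : nat) (u : R) :
  (m < n)%nat -> 0 <= u <= 1 -> before (track n) (point (track m) u).
Proof.
  intros hmn hu. induction hmn as [|n _ IH].
  - now apply point_before_next.
  - now apply before_next.
Qed.

Lemma eel_cone_condition (t tau : R) : 0 <= t < tau ->
  cone_condition (glue (fun n => velocity (track n)) tau) (vsub (eel t) (eel tau)).
Proof.
  intros h. unfold eel, glue.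
  assert (ht := nfloor_bounds t ltac:(lra)). assert (htau := nfloor_bounds tau ltac:(lra)).
  destruct (Nat.lt_trichotomy (nfloor t) (nfloor tau)) as [hl|[e|hl]].
  - apply before_cone_condition; [lra|]. apply point_before_track; [exact hl | lra].
  - rewrite e in *. apply own_cone_condition. lra.
  - apply le_INR in hl. rewrite S_INR in hl. lra.
Qed.

(** * Length and limit *)

Definition stage (p : piece) : nat :=
  match p with Entry k => k | Radial k _ => k | Helix k _ => k end.

(** Stage [k] starts at its lowest height [- 6 * size k] and stays within [size k / 120] of the
    axis. Since [8 * size k = (/ 2) ^ k], this gives both the unit ball and the limit. *)
Lemma vnorm_point_le (p : piece) (u : R) : 0 <= u <= 1 -> vnorm (point p u) <= 8 * size (stage p).
Proof.
  intros hu. eapply Rle_trans; [apply vnorm_le_sum|].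
  destruct p as [k|k j|k j]; assert (hs := size_pos k); cbn [stage];
    unfold point, px, py, pz; cbn [fst snd].
  - assert (hr := radius_pos k (S (2 * 2 ^ k))). assert (hr' := radius_le k (S (2 * 2 ^ k))).
    assert (hq := radius_pos k 0). assert (hq' := radius_le k 0).
    set (r := radius k _) in *.
    assert (0 <= size k * u <= size k) by nra.
    rewrite Rabs_R0, (Rabs_right (_ + _)) by nra.
    unfold base. rewrite Rabs_left by nra. nra.
  - assert (hr := radius_pos k (S j)). assert (hr' := radius_le k (S j)).
    assert (hq := radius_pos k j). assert (hq' := radius_le k j).
    assert (hl := level_range k j 0 ltac:(lra)). unfold base in hl.
    rewrite Rabs_R0, (Rabs_right (_ + _)), Rabs_left by nra. nra.
  - assert (hq := radius_pos k j). assert (hq' := radius_le k j).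
    assert (hl := level_range k j u hu). unfold base in hl.
    rewrite (Rabs_left (_ + _)) by lra.
    rewrite !Rabs_mult, (Rabs_right (radius k j)) by lra.
    assert (hc : Rabs (cos (omega j * u)) <= 1) by (apply Rabs_le, COS_bound).
    assert (hn : Rabs (sin (omega j * u)) <= 1) by (apply Rabs_le, SIN_bound).
    nra.
Qed.

Lemma size_antitone (k l : nat) : (k <= l)%nat -> size l <= size k.
Proof.
  induction 1 as [|l _ IH]; [lra|]. rewrite size_S. assert (h := size_pos l). lra.
Qed.

Lemma stage_track_mono (m n : nat) : (m <= n)%nat -> (stage (track m) <= stage (track n))%nat.
Proof.
  induction 1 as [|n _ IH]; [lia|]. eapply Nat.le_trans; [exact IH|].
  change (track (S n)) with (next (track n)).
  destruct (track n) as [k|k j|k [|j]]; simpl; lia.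
Qed.

Lemma track_reaches (k : nat) : exists n, track n = Entry k.
Proof.
  assert (H : forall j k n, track n = Radial k j -> exists m, track m = Entry (S k)).
  { induction j as [|j IH]; intros l n h.
    - exists (S (S n)). simpl. fold (track n). now rewrite h.
    - apply (IH l (S (S n))). simpl. fold (track n). now rewrite h. }
  induction k as [|k [n IH]]; [now exists O|].
  apply (H (2 * 2 ^ k)%nat k (S n)). change (next (track n) = Radial k (2 * 2 ^ k)).
  now rewrite IH.
Qed.

(* Lower bound for the length run before [p]: stage [k] has [2 * 2 ^ k + 1] helices, each of
   height [size k = / 8 * / 2 ^ k], so that a full stage is worth more than [/ 4]. *)
Definition credit (p : piece) : R :=
  match p with
  | Entry k => INR k / 4
  | Radial k j | Helix k j => INR k / 4 + (2 * 2 ^ k - INR j) * size k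
  end.

(** Only helices earn credit: the chord of a helix is at least its height [size k]. *)
Lemma credit_next (p : piece) :
  credit (next p) <= credit p + vnorm (vsub (point p 0) (point p 1)).
Proof.
  assert (hn := vnorm_nonneg (vsub (point p 0) (point p 1))).
  destruct p as [k|k j|k j].
  - unfold credit, next. rewrite mult_INR, pow_INR. simpl (INR 2).
    replace (1 + 1) with 2 by ring. lra.
  - simpl in *. lra.
  - assert (hz := Rabs_pz_le_vnorm (vsub (point (Helix k j) 0) (point (Helix k j) 1))).
    assert (hs := size_pos k).
    assert (e : Rabs (pz (vsub (point (Helix k j) 0) (point (Helix k j) 1))) = size k).
    { rewrite vsub_coords. unfold point, pz; cbn [snd].
      unfold sense. destruct (Nat.even j); [rewrite Rabs_left by lra | rewrite Rabs_right by lra];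
        ring. }
    (* Converts the credit [2 * 2 ^ k * size k] of a finished stage into [/ 4]. *)
    assert (e8 : 2 ^ k * size k = / 8).
    { unfold size. rewrite (Rmult_comm (/ 8)), <- Rmult_assoc, <- Rpow_mult_distr.
      rewrite Rinv_r by lra. rewrite pow1. ring. }
    rewrite e in hz. destruct j as [|j]; unfold credit, next; rewrite S_INR; [simpl INR|]; nra.
Qed.

Lemma credit_le_poly_length (n : nat) : credit (track n) <= poly_length eel INR n.
Proof.
  induction n as [|n IH].
  - simpl. lra.
  - assert (h := credit_next (track n)). cbn [poly_length].
    rewrite !eel_INR, <- track_join. change (track (S n)) with (next (track n)). lra.
Qed.

Theorem theorem4p2 :
  exists g : R -> vec3,
    is_eel (1 / sqrt 5) (fun t => 0 <= t) g /\
    (forall t, 0 <= t -> vnorm (g t) <= 1) /\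
    infinite_length (fun t => 0 <= t) g /\
    (exists L : vec3, forall eps, 0 < eps -> exists T, forall t, T <= t ->
       vnorm (vsub (g t) L) < eps).
Proof.
  assert (hder : forall n u, vderiv (point (track n)) u (velocity (track n) u))
    by (intros; apply vderiv_point).
  assert (hle : forall t, 0 <= t -> vnorm (eel t) <= 8 * size (stage (track (nfloor t)))).
  { intros t ht. assert (h := nfloor_bounds t ht). apply vnorm_point_le. lra. }
  exists eel. split; [split|split; [|split]].
  - eapply glue_continuous; [exact track_join | exact hder].
  - exists (glue (fun n => velocity (track n))). split.
    + intros t ht. split; [now apply glue_right_deriv | apply velocity_neq0].
    + intros t tau ht _ h. now apply eel_cone_condition.
  - intros t ht. eapply Rle_trans; [now apply hle|].
    assert (h := size_antitone 0 (stage (track (nfloor t))) ltac:(lia)).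
    unfold size in h at 2. simpl in h. lra.
  - intros M. destruct (INR_unbounded (4 * M)) as [k hk].
    destruct (track_reaches k) as [n hn].
    (* The polygon has its vertices at the joins, which are the integer times. *)
    exists n, INR. split; [intros; apply pos_INR|]. split.
    + intros i _. apply lt_INR. lia.
    + assert (h := credit_le_poly_length n). rewrite hn in h. simpl in h. lra.
  - exists vzero. intros eps heps.
    destruct (pow_lt_1_zero (/ 2)) with (y := eps) as [k hk];
      [rewrite Rabs_right; lra | exact heps |].
    specialize (hk k (Nat.le_refl k)).
    destruct (track_reaches k) as [n hn].
    exists (INR n). intros t ht. assert (h0 := pos_INR n).
    replace (vsub (eel t) vzero) with (eel t).
    2:{ rewrite vsub_coords. destruct (eel t) as [[x y] z].
        unfold vzero, px, py, pz; simpl. f_equal; [f_equal|]; ring. }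
    eapply Rle_lt_trans; [apply hle; lra|].
    assert (hf := nfloor_bounds t ltac:(lra)).
    assert (hnt : (n <= nfloor t)%nat).
    { apply INR_le. destruct (Nat.le_gt_cases n (nfloor t)) as [h|h]; [now apply le_INR|].
      apply le_INR in h. rewrite S_INR in h. lra. }
    assert (hst := stage_track_mono _ _ hnt). rewrite hn in hst.
    assert (h := size_antitone k _ hst).
    assert (hp : 0 < (/ 2) ^ k) by (apply pow_lt; lra).
    rewrite Rabs_right in hk by lra. unfold size in h at 2. lra.
Qed.
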